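(* Let $G$ be a simple $(m,r)$-graph such that $\binom{m-1}{2}\le r\le\binom{m}{2}$, and let $k:=\binom{m}{2}$. Then $$\Sigma(G)\le m(m-1)(m-2)+(k-r)(k-r-1)-4(k-r)(m-2)+2r.$$
   Context: An $(m,r)$-graph is a graph with vertex set $\{1,\dots,m\}$ and exactly $r$ edges. For a simple $(m,r)$-graph $G$, $g_i(G)$ is the degree of vertex $i$, and $\Sigma(G):=\sum_{i=1}^m g_i(G)^2$. *)

(* Defs.v *)
From mathcomp Require Import all_boot.

Set Implicit Arguments.
Unset Strict Implicit.
Unset Printing Implicit Defensive.

(* The vertices 1, ..., m are numbered 0, ..., m - 1, as elements of 'I_m. *)
Record simple_graph (m : nat) := SimpleGraph {
  adj : rel 'I_m;
  adj_sym : symmetric adj;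
  adj_irrefl : irreflexive adj
}.

(* Edges are unordered pairs, so that each edge is counted once. *)
Definition edges (m : nat) (G : simple_graph m) : {set {set 'I_m}} :=
  [set [set p.1; p.2] | p : 'I_m * 'I_m & adj G p.1 p.2].

Definition is_mr_graph (m r : nat) (G : simple_graph m) : Prop :=
  #|edges G| = r.

Definition degree (m : nat) (G : simple_graph m) (i : 'I_m) : nat :=
  #|[set j | adj G i j]|.

Definition Sigma (m : nat) (G : simple_graph m) : nat :=
  \sum_(i < m) degree G i ^ 2.

(* Main.v *)
(* If the complement of G has s = k - r edges and degrees d i = m - 1 - g i,
   then the claimed bound is equivalent to sum_i (d i)^2 <= s (s + 1).  The
   left-hand side equals the sum of d i + d j over the edges {i, j} of the
   complement, and d i + d j <= s + 1 for each of them, because {i, j} is the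
   only edge incident to both i and j. *)
Require Import Defs.
From HB Require Import structures.
From mathcomp Require Import all_boot all_order all_algebra.
From mathcomp Require Import zify ring.
Set Implicit Arguments.
Unset Strict Implicit.
Unset Printing Implicit Defensive.
Import Order.TTheory GRing.Theory Num.Theory.
Local Open Scope ring_scope.

Lemma set2_pair_eq (T : finType) (p q : T * T) :
  ([set p.1; p.2] == [set q.1; q.2]) = (p == q) || (p == (q.2, q.1)).
Proof.
case: p q => [a b] [c d] /=; rewrite !xpair_eqE.
apply/eqP/orP => [/setP E | [] /andP[/eqP-> /eqP->] //]; last exact: setUC.
have := E a; have := E b; have := E c; have := E d.
rewrite !inE !eqxx /= !orbT.
rewrite !(eq_sym c) !(eq_sym d).
case: (a == c); case: (a == d); case: (b == c); case: (b == d) => //=; auto.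
Qed.

Section RelationDegree.

Local Open Scope nat_scope.
Variables (T : finType) (e : rel T).
Hypotheses (e_sym : symmetric e) (e_irr : irreflexive e).

Definition rel_degree (i : T) : nat := \sum_j e i j.

(** Each vertex [u] other than [i], [j] has degree at least [e i u + e j u]. Summed over [u], this
    gives all of both degrees except the edge itself, counted once at each end: hence the [.+2].
    Doubling avoids halving the degree sum. *)
Lemma rel_degree_edge_le (i j : T) :
  e i j -> (rel_degree i + rel_degree j).*2 <= (\sum_u rel_degree u).+2.
Proof.
move=> eij.
have neq_ji : j != i by apply: contraTneq eij => ->; rewrite e_irr.
have split_sum (F : T -> nat) :
    \sum_u F u = F i + (F j + \sum_(u | (u != i) && (u != j)) F u).
  by rewrite (bigD1 i) //= (bigD1 j).
have le_rest : \sum_(u | (u != i) && (u != j)) (e i u + e j u) <=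
    \sum_(u | (u != i) && (u != j)) rel_degree u.
  apply: leq_sum => u _; rewrite /rel_degree split_sum !(e_sym u) addnA.
  exact: leq_addr.
have di := split_sum (fun u => nat_of_bool (e i u)).
have dj := split_sum (fun u => nat_of_bool (e j u)).
rewrite split_sum; move: le_rest; rewrite big_split /= => le_rest.
rewrite -/(rel_degree i) -/(rel_degree j) in di dj.
move: di dj; rewrite !e_irr (e_sym j i) eij /=; lia.
Qed.

(** When the degree sum is [2 * s], this reads: the sum of squares is at most [s * (s + 1)]. *)
Lemma sum_rel_degree_sqr_le :
  (\sum_i rel_degree i ^ 2) * 4
    <= (\sum_i rel_degree i) * (\sum_i rel_degree i).+2.
Proof.
have sqrE : \sum_i rel_degree i ^ 2 = \sum_i \sum_j e i j * rel_degree i.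
  by apply: eq_bigr => i _; rewrite -big_distrl.
have sqrE' : \sum_i rel_degree i ^ 2 = \sum_i \sum_j e i j * rel_degree j.
  rewrite sqrE exchange_big /=; apply: eq_bigr => i _.
  by apply: eq_bigr => j _; rewrite e_sym.
(* Averaging [sqrE] and [sqrE'] attaches the symmetric weight of the edge bound to every ordered
   adjacent pair. *)
have -> : (\sum_i rel_degree i ^ 2) * 4 =
    \sum_i \sum_j e i j * (rel_degree i + rel_degree j).*2.
  transitivity ((\sum_i \sum_j e i j * rel_degree i
               + \sum_i \sum_j e i j * rel_degree j) * 2).
    by rewrite -sqrE -sqrE'; lia.
  rewrite -big_split big_distrl; apply: eq_bigr => i _ /=.
  rewrite -big_split big_distrl; apply: eq_bigr => j _ /=; lia.
rewrite big_distrl; apply: leq_sum => i _ /=.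
(* Expanding the factor [rel_degree i] on the right makes both sides sums over pairs, compared
   termwise. *)
rewrite {2}/rel_degree big_distrl; apply: leq_sum => j _ /=.
by case: (boolP (e i j)) => // eij; rewrite !mul1n rel_degree_edge_le.
Qed.

End RelationDegree.

Section Handshake.

Local Open Scope nat_scope.
Variables (m : nat) (G : simple_graph m).

Lemma degreeE (i : 'I_m) : degree G i = rel_degree (adj G) i.
Proof.
rewrite /degree /rel_degree -sum1_card big_mkcond /=.
by apply: eq_bigr => j _; rewrite inE; case: adj.
Qed.

(** Ordered adjacent pairs are grouped by their underlying edge; each fibre consists of a pair and
    its swap, distinct since there are no loops. *)
Lemma handshake : \sum_i degree G i = #|edges G| * 2.
Proof.
transitivity (\sum_(p : 'I_m * 'I_m | adj G p.1 p.2) 1).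
  rewrite -(pair_big_dep predT (adj G) (fun _ _ => 1)) /=.
  apply: eq_bigr => i _; rewrite degreeE [RHS]big_mkcond /=.
  by apply: eq_bigr => j _; case: adj.
pose f (p : 'I_m * 'I_m) := [set p.1; p.2].
rewrite (partition_big f [in edges G]) /=; last first.
  by move=> p Gp; apply/imsetP; exists p; rewrite ?inE.
rewrite -sum_nat_const; apply: eq_bigr => _ /imsetP[q + ->].
rewrite inE => Gq.
have neq_q : q != (q.2, q.1).
  apply: contraTneq Gq => /(congr1 fst) /= ->.
  by rewrite adj_irrefl.
have -> : 2 = #|[set q; (q.2, q.1)]| by rewrite cards2 neq_q.
rewrite sum1_card; apply: eq_card => p.
rewrite unfold_in /= !inE /f set2_pair_eq.
case: eqP => [-> | _]; first by rewrite Gq.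
by case: eqP => [-> | _]; rewrite ?andbF //= adj_sym Gq.
Qed.

Definition nonadj (i j : 'I_m) : bool := (i != j) && ~~ adj G i j.

Lemma nonadj_sym : symmetric nonadj.
Proof. by move=> i j; rewrite /nonadj eq_sym adj_sym. Qed.

Lemma nonadj_irrefl : irreflexive nonadj.
Proof. by move=> i; rewrite /nonadj eqxx. Qed.

Lemma degree_nonadj (i : 'I_m) : (degree G i + rel_degree nonadj i).+1 = m.
Proof.
have -> : degree G i + rel_degree nonadj i = #|predC1 i|.
  rewrite degreeE -big_split -sum1_card [RHS]big_mkcond /=.
  apply: eq_bigr => j _; rewrite /nonadj inE eq_sym.
  by case: eqVneq => [-> | _]; rewrite ?adj_irrefl //; case: adj.
by rewrite cardC1 card_ord prednK // (leq_ltn_trans _ (ltn_ord i)).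
Qed.

End Handshake.

Lemma Posz_sum (I : finType) (F : I -> nat) :
  (\sum_i F i)%N%:Z = \sum_i (F i)%:Z.
Proof. by rewrite -natz natr_sum; apply: eq_bigr => i _; rewrite natz. Qed.

Theorem corollary16 (m r : nat) (G : simple_graph m)
    (hG : is_mr_graph r G)
    (hr : ('C(m - 1, 2) <= r <= 'C(m, 2))%N) :
  let k : nat := 'C(m, 2) in
  (Sigma G)%:Z <=
    m%:Z * (m%:Z - 1) * (m%:Z - 2)
    + (k%:Z - r%:Z) * (k%:Z - r%:Z - 1)
    - 4 * (k%:Z - r%:Z) * (m%:Z - 2)
    + 2 * r%:Z.
Proof.
lazy zeta; set k : nat := 'C(m, 2).
set d := rel_degree (nonadj G).
have degZ i : (degree G i)%:Z = m%:Z - 1 - (d i)%:Z.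
  by have := degree_nonadj G i; rewrite -/d; lia.
have sum_deg : \sum_(i < m) (degree G i)%:Z = r%:Z * 2.
  by rewrite -hG -PoszM -handshake Posz_sum.
have kE : k%:Z * 2 = m%:Z * (m%:Z - 1).
  have := bin_ffact m 2; rewrite -/k -[2`!]/2%N ffactnS ffactn1.
  (* The case split removes the truncated predecessor of [m]. *)
  by case: (m) => [|n] /=; lia.
(* Subtracting degree sums gives this without forming the edge set of the complement. *)
have sum_d : \sum_(i < m) (d i)%:Z = (k%:Z - r%:Z) * 2.
  have : \sum_(i < m) ((degree G i)%:Z + (d i)%:Z) = m%:Z * (m%:Z - 1).
    under eq_bigr => i _ do rewrite degZ subrK.
    by rewrite sumr_const card_ord -[LHS]mulr_natl natz.
  rewrite big_split /= sum_deg -kE => sumE.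
  by apply: (addrI (r%:Z * 2)); rewrite sumE; ring.
have Sigma_eq : (Sigma G)%:Z = m%:Z * (m%:Z - 1) ^+ 2
    - 2 * (m%:Z - 1) * \sum_(i < m) (d i)%:Z + \sum_(i < m) (d i)%:Z ^+ 2.
  have -> : m%:Z * (m%:Z - 1) ^+ 2 = \sum_(i < m) (m%:Z - 1) ^+ 2.
    by rewrite sumr_const card_ord -[RHS]mulr_natl natz.
  rewrite /Sigma Posz_sum mulr_sumr -sumrB -big_split.
  by apply: eq_bigr => i _ /=; rewrite -mulnn PoszM degZ; ring.
have sqr_le : (\sum_(i < m) (d i)%:Z ^+ 2) * 4
    <= (\sum_(i < m) (d i)%:Z) * (\sum_(i < m) (d i)%:Z + 2).
  have := sum_rel_degree_sqr_le (nonadj_sym G) (nonadj_irrefl G).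
  rewrite -lez_nat !PoszM !Posz_sum -(addn2 (bigop _ _ _)) PoszD Posz_sum.
  by under eq_bigr => i _ do rewrite -mulnn PoszM -expr2.
rewrite Sigma_eq; move: sqr_le; rewrite sum_d.
move: (\sum_(i < m) (d i)%:Z ^+ 2) => S sqr_le.
(* With [s = k - r], [sqr_le] says [S <= s * (s + 1)]; putting [s * (s + 1)] for [S] gives exactly
   the claimed bound, by [kE]. *)
nia.
Qed.
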